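(* Let $K$ be a field of characteristic $0$ and let $U$ be a $\mathbb{Z}$-graded Galois $\Gamma$-ring in $\mathcal{A}=F*\mathbb{Z}$. Then the ideals of $\mathbb{Z}$-graded identities satisfy $T_{\mathbb{Z}}(U)=T_{\mathbb{Z}}(\mathcal{A})$.
   Context: All algebras and fields are $K$-algebras. Skew group algebra: for a field $L$ and a group $G$ acting on $L$ by automorphisms through $\varphi\colon G\to \mathrm{Aut}(L)$, $L*G$ is the $L$-vector space with basis $G$ and multiplication $(a_1g_1)(a_2g_2)=(a_1\varphi(g_1)(a_2))(g_1g_2)$; it is $G$-graded with $Lg$ in degree $g$. $\mathbb{Z}$-graded Galois ring: let $\Gamma$ be an affine (finitely generated commutative) integral domain over $K$ and $U$ a finitely generated associative $\Gamma$-algebra. Let $F$ be the field of fractions of $\Gamma$, and $\theta$ a $K$-automorphism of $\Gamma$ of infinite order, extended canonically to $F$, with $\langle\theta\rangle$ identified with $\mathbb{Z}$; form $F*\mathbb{Z}$ with this action and its natural $\mathbb{Z}$-grading. $U$ is a $\mathbb{Z}$-graded Galois $\Gamma$-ring in $F*\mathbb{Z}$ if $U$ is a subalgebra of $F*\mathbb{Z}$, $FU=UF=F*\mathbb{Z}$, $U$ is $\mathbb{Z}$-graded with $\Gamma\subset U_0$ (the degree $0$ component), and the inclusion $U\hookrightarrow F*\mathbb{Z}$ is an injective homomorphism respecting the $\mathbb{Z}$-gradings. Graded identities: $K\langle X\mid\mathbb{Z}\rangle$ is the free unital associative $K$-algebra on a disjoint union $X=\bigcup_{n\in\mathbb{Z}}X_n$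 of countably infinite sets, the variables in $X_n$ having degree $n$. For a $\mathbb{Z}$-graded algebra $A$, $T_{\mathbb{Z}}(A)$ is the ideal of all $f\in K\langle X\mid\mathbb{Z}\rangle$ that vanish under every substitution of each variable by a homogeneous element of $A$ of the same degree. *)

(* Defs.v *)
From HB Require Import structures.
From mathcomp Require Import all_boot all_order all_algebra.
From mathcomp Require Import finmap.
From mathcomp.multinomials Require Export monalg.

Set Implicit Arguments.
Unset Strict Implicit.
Unset Printing Implicit Defensive.

Import GRing.Theory.
Local Open Scope fset_scope.
Local Open Scope ring_scope.

#[short(type="idomAlgType")]
HB.structure Definition IdomAlgebra (K : comNzRingType) :=
  {A of GRing.ComUnitAlgebra K A & GRing.IntegralDomain A}.

Notation "x %:F" := (@FracField.tofrac _ x) : ring_scope.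

Record algAut (K : comNzRingType) (A : algType K) := AlgAut {
  aut_fun :> {lrmorphism A -> A};
  aut_inv : {lrmorphism A -> A};
  aut_funK : cancel aut_fun aut_inv;
  aut_invK : cancel aut_inv aut_fun
}.

Definition autV (K : comNzRingType) (A : algType K) (t : algAut A) : algAut A :=
  AlgAut (aut_invK t) (aut_funK t).

Definition aut_infinite_order (K : comNzRingType) (A : algType K)
    (t : algAut A) : Prop :=
  forall n : nat, (0 < n)%N -> ~ (iter n t =1 id).

Definition autX (K : comNzRingType) (A : algType K) (t : algAut A) (n : int) :
    A -> A :=
  match n with
  | Posz n => iter n t
  | Negz n => iter n.+1 (autV t)
  end.

Section AutPower.
Variables (K : comNzRingType) (A : algType K) (t : algAut A).

Lemma autX_zmod n : zmod_morphism (autX t n).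
Proof.
have H (f : {lrmorphism A -> A}) m : zmod_morphism (iter m f).
  by move=> x y; elim: m => //= m ->; rewrite rmorphB.
by case: n => n; apply: H.
Qed.

Lemma autX_monoid n : monoid_morphism (autX t n).
Proof.
have H (f : {lrmorphism A -> A}) m : monoid_morphism (iter m f).
  split; first by elim: m => //= m ->; rewrite rmorph1.
  by move=> x y; elim: m => //= m ->; rewrite rmorphM.
by case: n => n; apply: H.
Qed.

Lemma autX_scalable n : scalable (autX t n).
Proof.
have H (f : {lrmorphism A -> A}) m : scalable (iter m f).
  by move=> k x; elim: m => //= m ->; rewrite linearZ.
by case: n => n; apply: H.
Qed.

HB.instance Definition _ n :=
  GRing.isZmodMorphism.Build A A (autX t n) (autX_zmod n).
HB.instance Definition _ n :=
  GRing.isMonoidMorphism.Build A A (autX t n) (autX_monoid n).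
HB.instance Definition _ n :=
  GRing.isScalable.Build K A A *:%R (autX t n) (autX_scalable n).

Lemma autX0 : autX t 0 =1 id. Proof. by []. Qed.

Lemma autXS n x : autX t (1 + n) x = t (autX t n x).
Proof.
case: n => [n|n]; first by rewrite -PoszD add1n.
rewrite NegzE; case: n => [|n].
  by rewrite subrr /= aut_invK.
have -> : 1 - n.+2%:Z = Negz n by rewrite NegzE -addn1 PoszD opprD addrC addrNK.
by rewrite -NegzE /= aut_invK.
Qed.

Lemma autXP n x : autX t (-1 + n) x = aut_inv t (autX t n x).
Proof. by rewrite -{2}(addrK (-1) n) opprK addrC [_ + 1]addrC autXS aut_funK. Qed.

Lemma autXD m n : autX t (m + n) =1 autX t m \o autX t n.
Proof.
move=> x /=; elim/int_ind: m => [|m IH|m IH]; first by rewrite add0r.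
  by rewrite -addn1 PoszD addrC [m%:Z + _]addrC addrCA [n + _]addrC !autXS IH.
by rewrite -addn1 PoszD opprD addrAC ![_ - 1]addrC !autXP IH.
Qed.

End AutPower.

Section FracAlgebra.
Variables (K : comNzRingType) (D : idomAlgType K).
Implicit Types (x : {fraction D}) (k : K).

Definition frac_scale k x : {fraction D} := (k%:A : D)%:F * x.

Lemma frac_scaleA k l x : frac_scale k (frac_scale l x) = frac_scale (k * l) x.
Proof. by rewrite /frac_scale mulrA -rmorphM -scalerAl mul1r scalerA. Qed.

Lemma frac_scale1 : left_id 1 frac_scale.
Proof. by move=> x; rewrite /frac_scale scale1r rmorph1 mul1r. Qed.

Lemma frac_scaleDr : right_distributive frac_scale +%R.
Proof. by move=> k x y; rewrite /frac_scale mulrDr. Qed.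

Lemma frac_scaleDl x : {morph frac_scale^~ x : k l / k + l}.
Proof. by move=> k l; rewrite /frac_scale scalerDl rmorphD mulrDl. Qed.

HB.instance Definition _ := GRing.Zmodule_isLmodule.Build K {fraction D}
  frac_scaleA frac_scale1 frac_scaleDr frac_scaleDl.

Lemma frac_scaleAl k x y : k *: (x * y) = (k *: x) * y.
Proof. by rewrite /GRing.scale /= /frac_scale mulrA. Qed.

HB.instance Definition _ :=
  GRing.Lmodule_isLalgebra.Build K {fraction D} frac_scaleAl.
HB.instance Definition _ :=
  GRing.Lalgebra_isComAlgebra.Build K {fraction D}.

Lemma tofrac_scalable : scalable (@FracField.tofrac D).
Proof.
move=> k a; rewrite -[RHS]/((k%:A : D)%:F * a%:F) -rmorphM.
by rewrite -scalerAl mul1r.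
Qed.

HB.instance Definition _ :=
  GRing.isScalable.Build K D {fraction D} *:%R (@FracField.tofrac D)
    tofrac_scalable.

Lemma frac_reprE x : x = (\n_(repr x))%:F / (\d_(repr x))%:F.
Proof.
have d0 : (\d_(repr x))%:F != 0 :> {fraction D} by rewrite tofrac_eq0 denom_ratioP.
apply: (mulIf d0); rewrite divfK // -{1}[x]reprK; set y := repr x.
rewrite !piE; apply/eqmodP; rewrite /= FracField.equivfE.
rewrite /FracField.mulf !numden_Ratio ?oner_eq0 ?mulr1 ?denom_ratioP //.
by rewrite mulrC.
Qed.

Variable t : algAut D.

(* The image of a fraction a / b is t a / t b. *)
Definition frac_map x : {fraction D} :=
  (t \n_(repr x))%:F / (t \d_(repr x))%:F.

Lemma aut_eq0 a : (t a == 0) = (a == 0).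
Proof. by rewrite -(inj_eq (can_inj (aut_funK t))) rmorph0. Qed.

Lemma frac_mapE a b : b != 0 -> frac_map (a%:F / b%:F) = (t a)%:F / (t b)%:F.
Proof.
move=> b0; rewrite /frac_map; set x := a%:F / b%:F.
have d0 : \d_(repr x) != 0 by apply: denom_ratioP.
have /eqP := frac_reprE x.
rewrite {1}/x eqr_div ?tofrac_eq0 // -!rmorphM /= tofrac_eq => /eqP E.
apply/eqP; rewrite eqr_div ?tofrac_eq0 ?aut_eq0 // -!rmorphM /= tofrac_eq.
by rewrite E.
Qed.

Lemma frac_map_tofrac a : frac_map a%:F = (t a)%:F.
Proof.
have /= := frac_mapE a (oner_neq0 D).
by rewrite !rmorph1 !invr1 !mulr1.
Qed.

Lemma frac_ind (P : {fraction D} -> Prop) :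
  (forall a b, b != 0 -> P (a%:F / b%:F)) -> forall x, P x.
Proof. by move=> H x; rewrite [x]frac_reprE; apply: H; apply: denom_ratioP. Qed.

Lemma frac_map_monoid : monoid_morphism frac_map.
Proof.
split; first by rewrite -[1](rmorph1 (@FracField.tofrac D)) frac_map_tofrac !rmorph1.
elim/frac_ind => a b b0; elim/frac_ind => c d d0.
rewrite mulf_div -!rmorphM /= !frac_mapE ?mulf_neq0 //.
by rewrite mulf_div !rmorphM.
Qed.

Lemma frac_map_zmod : zmod_morphism frac_map.
Proof.
elim/frac_ind => a b b0; elim/frac_ind => c d d0.
rewrite -mulNr addf_div ?tofrac_eq0 // -rmorphN -!rmorphM -rmorphD /=.
rewrite !frac_mapE ?mulf_neq0 // -mulNr addf_div ?tofrac_eq0 ?aut_eq0 //.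
by rewrite !(rmorphD, rmorphM, rmorphN).
Qed.

HB.instance Definition _ :=
  GRing.isZmodMorphism.Build {fraction D} {fraction D} frac_map frac_map_zmod.
HB.instance Definition _ :=
  GRing.isMonoidMorphism.Build {fraction D} {fraction D} frac_map
    frac_map_monoid.

Lemma frac_map_scalable : scalable frac_map.
Proof.
move=> k x; rewrite -[k *: x]/((k%:A : D)%:F * x) rmorphM /= frac_map_tofrac.
by rewrite linearZ /= rmorph1.
Qed.

HB.instance Definition _ :=
  GRing.isScalable.Build K {fraction D} {fraction D} *:%R frac_map
    frac_map_scalable.

End FracAlgebra.

Section FracAut.
Variables (K : comNzRingType) (D : idomAlgType K) (t : algAut D).

Lemma frac_mapK (u v : algAut D) :
  cancel u v -> cancel (frac_map u) (frac_map v).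
Proof.
move=> uK; elim/frac_ind => a b b0.
by rewrite !frac_mapE ?aut_eq0 // !uK.
Qed.

Definition frac_aut : algAut {fraction D} :=
  @AlgAut K _ (frac_map t) (frac_map (autV t))
    (frac_mapK (u := t) (v := autV t) (aut_funK t))
    (frac_mapK (u := autV t) (v := t) (aut_invK t)).

End FracAut.

(* By [act0] and [actD], each [act g] is an automorphism, with inverse
   [act (- g)]. *)
Record algAction (K : comNzRingType) (G : zmodType) (L : algType K) :=
  AlgAction {
  act :> G -> {lrmorphism L -> L};
  act0 : act 0 =1 id;
  actD : forall g h, act (g + h) =1 act g \o act h
}.

Definition aut_action (K : comNzRingType) (L : algType K) (t : algAut L) :
    algAction int L :=
  @AlgAction K int L (fun n => autX t n) (autX0 t) (autXD t).

(* For an additively written abelian group G: the finitely supported functions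
   from G to L, with product (a g) (b h) = (a (phi g b)) (g + h). *)
Definition skewalg (K : comNzRingType) (G : zmodType) (L : algType K)
  (phi : algAction G L) : Type := {malg L[G]}.

Section SkewAlgebra.
Variables (K : comNzRingType) (G : zmodType) (L : algType K).
Variable phi : algAction G L.
Local Notation A := (skewalg phi).

HB.instance Definition _ := GRing.Zmodule.on A.

Definition skewU (g : G) (a : L) : A := << a *g g >>.

Definition skew_coef (u : A) (g : G) : L := mcoeff g u.

Definition skew_mul (u v : A) : A :=
  \sum_(g <- msupp u) \sum_(h <- msupp v)
    skewU (g + h) (skew_coef u g * phi g (skew_coef v h)).

Definition skew_one : A := skewU 0 1.

Definition skew_scale (k : K) (u : A) : A :=
  \sum_(g <- msupp u) skewU g (k *: skew_coef u g).

Lemma skewU_is_zmod g : zmod_morphism (skewU g).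
Proof. by move=> a b; rewrite /skewU; apply: raddfB. Qed.

HB.instance Definition _ g :=
  GRing.isZmodMorphism.Build L A (skewU g) (skewU_is_zmod g).

Lemma skew_coef_zmod g : zmod_morphism (skew_coef^~ g).
Proof. by move=> u v; rewrite /skew_coef; apply: raddfB. Qed.

Lemma skew_coefU g a h : skew_coef (skewU g a) h = a *+ (g == h).
Proof. exact: mcoeffU. Qed.

Lemma skew_coefD u v g : skew_coef (u + v) g = skew_coef u g + skew_coef v g.
Proof. exact: mcoeffD. Qed.

Lemma skewP (u v : A) : (forall g, skew_coef u g = skew_coef v g) -> u = v.
Proof. by move/malgP. Qed.

Lemma skewE (u : A) : u = \sum_(g <- msupp u) skewU g (skew_coef u g).
Proof. exact: monalgE. Qed.

Lemma skew_mulEw (d1 d2 : {fset G}) (u v : A) :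
  msupp u `<=` d1 -> msupp v `<=` d2 ->
  skew_mul u v = \sum_(g <- d1) \sum_(h <- d2)
    skewU (g + h) (skew_coef u g * phi g (skew_coef v h)).
Proof.
move=> le1 le2; rewrite /skew_mul (big_fset_incl _ le1) /=.
  apply/eq_bigr => g _; apply/big_fset_incl => // h _ /mcoeff_outdom vh.
  by rewrite /skew_coef vh rmorph0 mulr0 raddf0.
move=> g _ /mcoeff_outdom ug; rewrite big1 // => h _.
by rewrite /skew_coef ug mul0r raddf0.
Qed.

Lemma skew_mulUU g h a b :
  skew_mul (skewU g a) (skewU h b) = skewU (g + h) (a * phi g b).
Proof.
rewrite (skew_mulEw (d1 := [fset g]) (d2 := [fset h])) ?msuppU_le //.
by rewrite !big_seq_fset1 !skew_coefU !eqxx.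
Qed.

Lemma skew_mulDl : left_distributive skew_mul +%R.
Proof.
move=> u v w.
rewrite (skew_mulEw (msuppD_le u v) (fsubset_refl (msupp w))).
rewrite (skew_mulEw (fsubsetUl _ (msupp v)) (fsubset_refl (msupp w))).
rewrite (skew_mulEw (fsubsetUr (msupp u) _) (fsubset_refl (msupp w))).
rewrite -big_split; apply/eq_bigr => g _; rewrite -big_split.
by apply/eq_bigr => h _; rewrite skew_coefD mulrDl raddfD.
Qed.

Lemma skew_mulDr : right_distributive skew_mul +%R.
Proof.
move=> w u v.
rewrite (skew_mulEw (fsubset_refl (msupp w)) (msuppD_le u v)).
rewrite (skew_mulEw (fsubset_refl (msupp w)) (fsubsetUl _ (msupp v))).
rewrite (skew_mulEw (fsubset_refl (msupp w)) (fsubsetUr (msupp u) _)).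
rewrite -big_split; apply/eq_bigr => g _; rewrite -big_split.
by apply/eq_bigr => h _; rewrite skew_coefD rmorphD mulrDr raddfD.
Qed.

Lemma skew_mul0l : left_zero 0 skew_mul.
Proof. by move=> u; apply: (addrI (skew_mul 0 u)); rewrite -skew_mulDl !addr0. Qed.

Lemma skew_mul0r : right_zero 0 skew_mul.
Proof. by move=> u; apply: (addrI (skew_mul u 0)); rewrite -skew_mulDr !addr0. Qed.

Lemma skew_ind (P : A -> Prop) : P 0 -> (forall u v, P u -> P v -> P (u + v)) ->
  (forall g a, P (skewU g a)) -> forall u, P u.
Proof. by move=> P0 PD PU u; rewrite [u]skewE; apply: big_ind. Qed.

Lemma skew_mulA : associative skew_mul.
Proof.
move=> u v w; elim/skew_ind: u => [|u1 u2 H1 H2|g a].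
- by rewrite !skew_mul0l.
- by rewrite !skew_mulDl H1 H2.
elim/skew_ind: v => [|v1 v2 H1 H2|h b].
- by rewrite !(skew_mul0l, skew_mul0r).
- by rewrite !(skew_mulDl, skew_mulDr) H1 H2.
elim/skew_ind: w => [|w1 w2 H1 H2|k c].
- by rewrite !skew_mul0r.
- by rewrite !skew_mulDr H1 H2.
by rewrite !skew_mulUU rmorphM actD /= mulrA addrA.
Qed.

Lemma skew_mul1l : left_id skew_one skew_mul.
Proof.
elim/skew_ind => [|u v Hu Hv|g a]; first by rewrite skew_mul0r.
  by rewrite skew_mulDr Hu Hv.
by rewrite skew_mulUU act0 mul1r add0r.
Qed.

Lemma skew_mul1r : right_id skew_one skew_mul.
Proof.
elim/skew_ind => [|u v Hu Hv|g a]; first by rewrite skew_mul0l.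
  by rewrite skew_mulDl Hu Hv.
by rewrite skew_mulUU rmorph1 mulr1 addr0.
Qed.

Lemma skew_one_neq0 : skew_one != 0.
Proof.
apply/eqP => /(congr1 (skew_coef^~ 0)) /eqP.
by rewrite skew_coefU eqxx [X in _ == X]mcoeff0 oner_eq0.
Qed.

HB.instance Definition _ := GRing.Zmodule_isNzRing.Build A
  skew_mulA skew_mul1l skew_mul1r skew_mulDl skew_mulDr skew_one_neq0.

Lemma skew_scaleE k u g : skew_coef (skew_scale k u) g = k *: skew_coef u g.
Proof.
rewrite /skew_scale /skew_coef raddf_sum /=.
rewrite (eq_bigr (fun h => k *: (mcoeff g (skewU h (skew_coef u h))))).
  by rewrite -scaler_sumr -raddf_sum /= -skewE.
by move=> h _; rewrite !mcoeffU; case: eqP => // _; rewrite scaler0.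
Qed.

Lemma skew_scaleA k l u : skew_scale k (skew_scale l u) = skew_scale (k * l) u.
Proof. by apply: skewP => g; rewrite !skew_scaleE scalerA. Qed.

Lemma skew_scale1 : left_id 1 skew_scale.
Proof. by move=> u; apply: skewP => g; rewrite skew_scaleE scale1r. Qed.

Lemma skew_scaleDr : right_distributive skew_scale +%R.
Proof.
by move=> k u v; apply: skewP => g; rewrite !(skew_coefD, skew_scaleE) scalerDr.
Qed.

Lemma skew_scaleDl u : {morph skew_scale^~ u : k l / k + l}.
Proof.
by move=> k l; apply: skewP => g; rewrite !(skew_coefD, skew_scaleE) scalerDl.
Qed.

HB.instance Definition _ := GRing.Zmodule_isLmodule.Build K A
  skew_scaleA skew_scale1 skew_scaleDr skew_scaleDl.

Lemma skew_scaleU (k : K) g a : k *: skewU g a = skewU g (k *: a).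
Proof.
apply: skewP => h; rewrite skew_scaleE !skew_coefU.
by case: eqP => // _; rewrite scaler0.
Qed.

Lemma skewUM g h a b : skewU g a * skewU h b = skewU (g + h) (a * phi g b).
Proof. exact: skew_mulUU. Qed.

Lemma skew_scaleAl (k : K) (u v : A) : k *: (u * v) = (k *: u) * v.
Proof.
elim/skew_ind: u => [|u1 u2 H1 H2|g a]; first by rewrite mul0r scaler0 mul0r.
  by rewrite mulrDl !scalerDr mulrDl H1 H2.
elim/skew_ind: v => [|v1 v2 H1 H2|h b]; first by rewrite !mulr0 scaler0.
  by rewrite mulrDr scalerDr mulrDr H1 H2.
by rewrite skew_scaleU !skewUM skew_scaleU scalerAl.
Qed.

HB.instance Definition _ := GRing.Lmodule_isLalgebra.Build K A skew_scaleAl.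

Lemma skew_scaleAr (k : K) (u v : A) : k *: (u * v) = u * (k *: v).
Proof.
elim/skew_ind: u => [|u1 u2 H1 H2|g a]; first by rewrite !mul0r scaler0.
  by rewrite !mulrDl scalerDr H1 H2.
elim/skew_ind: v => [|v1 v2 H1 H2|h b]; first by rewrite !(mulr0, scaler0).
  by rewrite mulrDr !scalerDr mulrDr H1 H2.
by rewrite skew_scaleU !skewUM skew_scaleU linearZ scalerAr.
Qed.

HB.instance Definition _ := GRing.Lalgebra_isAlgebra.Build K A skew_scaleAr.

Definition skew_gr (g : G) (u : A) : Prop := exists a : L, u = skewU g a.

End SkewAlgebra.

Section Subsets.
Variables (K : comNzRingType) (A : algType K).
Implicit Types (U V S : A -> Prop).

Record submodule U : Prop := Submodule {
  submod0 : U 0;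
  submodP : forall (k : K) x y, U x -> U y -> U (k *: x + y)
}.

Record subalgebra U : Prop := Subalgebra {
  subalg_submod : submodule U;
  subalg1 : U 1;
  subalgM : forall x y, U x -> U y -> U (x * y)
}.

Definition subalg_gen S (x : A) : Prop :=
  forall B : A -> Prop, subalgebra B -> (forall y, S y -> B y) -> B x.

(* The set U V of the finite sums of products u v with u in U and v in V. *)
Definition prod_span U V (x : A) : Prop :=
  exists s : seq (A * A),
    (forall p, p \in s -> U p.1 /\ V p.2) /\ x = \sum_(p <- s) p.1 * p.2.

Record Zgrading U (Ugr : int -> A -> Prop) : Prop := {
  gr_submod : forall n, submodule (Ugr n);
  gr_sub : forall n x, Ugr n x -> U x;
  gr_span : forall x, U x -> exists (s : seq int) (c : int -> A),
    [/\ uniq s, forall n, Ugr n (c n) & x = \sum_(n <- s) c n];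
  gr_direct : forall (s : seq int) (c : int -> A),
    uniq s -> (forall n, Ugr n (c n)) -> \sum_(n <- s) c n = 0 ->
    forall n, n \in s -> c n = 0;
  gr_mul : forall m n x y, Ugr m x -> Ugr n y -> Ugr (m + n) (x * y)
}.

End Subsets.

Lemma skew_grading (K : comNzRingType) (L : algType K) (phi : algAction int L) :
  Zgrading (fun=> True) (@skew_gr K int L phi).
Proof.
split=> //.
- move=> n; split; first by exists 0; rewrite raddf0.
  by move=> k _ _ [a ->] [b ->]; exists (k *: a + b); rewrite raddfD skew_scaleU.
- move=> u _; exists (msupp u), (fun n => skewU phi n (skew_coef u n)).
  by split; [apply: fset_uniq | move=> n; exists (skew_coef u n) | apply: skewE].
- move=> s c s_uniq c_gr /(congr1 (fun u => skew_coef u)) E n sn.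
  have [a cn] := c_gr n; rewrite cn.
  suff -> : a = 0 by rewrite raddf0.
  have := congr1 (fun h => h n) E; rewrite /= /skew_coef raddf_sum /= mcoeff0.
  rewrite (bigD1_seq n) //= big1 ?addr0; first by rewrite cn mcoeffUU.
  move=> m /negPf mn; have [b ->] := c_gr m.
  by rewrite mcoeffU mn.
- move=> m n _ _ [a ->] [b ->]; exists (a * phi m b); exact: skewUM.
Qed.

Definition affine (K : comNzRingType) (A : algType K) : Prop :=
  exists s : seq A, forall x : A, subalg_gen (fun y => y \in s) x.

(* The free algebra K<X | Z>; the variable (n, i) is the i-th element of X_n,
   and words are sequences of variables. *)
Definition free_Zalg (K : nzRingType) := {malg K[{fmonom (int * nat)%type}]}.

Definition free_eval (K : comNzRingType) (A : algType K) (x : int * nat -> A)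
    (f : free_Zalg K) : A :=
  mmap (fun k : K => k%:A) (fun w : {fmonom (int * nat)%type} => \prod_(i <- w) x i) f.

(* The graded subspaces may live in a larger algebra A, so that this applies to
   a graded subalgebra of A as well as to A itself. *)
Definition graded_identity (K : comNzRingType) (A : algType K)
    (Ugr : int -> A -> Prop) (f : free_Zalg K) : Prop :=
  forall x : int * nat -> A, (forall i, Ugr i.1 (x i)) -> free_eval x f = 0.

Section GaloisRing.
Variables (K : fieldType) (D : idomAlgType K) (t : algAut D).

(* As t has infinite order, Z is identified with the group it generates: the
   integer n acts on the field of fractions as the n-th power of t. *)
Definition frac_skewZ := skewalg (aut_action (frac_aut t)).

HB.instance Definition _ := GRing.Algebra.on frac_skewZ.

Definition frac_gr : int -> frac_skewZ -> Prop :=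
  @skew_gr K int {fraction D} (aut_action (frac_aut t)).

Definition frac_in (u : frac_skewZ) : Prop :=
  exists a : {fraction D}, u = skewU (aut_action (frac_aut t)) 0 a.

Definition dom_in (u : frac_skewZ) : Prop :=
  exists a : D, u = skewU (aut_action (frac_aut t)) 0 a%:F.

(* D is in general not central in U, so a generating set of U over D generates
   U, together with D, as a K-algebra. *)
Record graded_Galois_ring (U : frac_skewZ -> Prop)
    (Ugr : int -> frac_skewZ -> Prop) : Prop := {
  Galois_subalg : subalgebra U;
  Galois_fg : exists s : seq frac_skewZ, forall u,
    U u <-> subalg_gen (fun y => dom_in y \/ y \in s) u;
  Galois_FU : forall u, prod_span frac_in U u;
  Galois_UF : forall u, prod_span U frac_in u;
  Galois_grading : Zgrading U Ugr;
  Galois_dom : forall u, dom_in u -> Ugr 0 u;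
  Galois_graded : forall n u, Ugr n u -> frac_gr n u
}.

End GaloisRing.

(* Main.v *)
Require Import Defs.
From mathcomp Require Import all_boot all_order all_algebra.
From mathcomp Require Import finmap.
From Stdlib Require Import IndefiniteDescription.
Import GRing.Theory.
Local Open Scope ring_scope.

Set Implicit Arguments.
Unset Strict Implicit.
Unset Printing Implicit Defensive.

(** Homogeneous elements of [U] are homogeneous in [F * Z], so an identity of
    [F * Z] is one of [U].  For the converse, every homogeneous [x] of [F * Z]
    is pushed into [U] by some nonzero [q] of [Gamma]: as [F U = F * Z], each
    degree contains a nonzero element of [U], and [x] is a fraction times it
    ([graded_Galois_denominator]).

    Let a substitution [x] be given, with such a denominator [q v] for each
    variable [v].  For [m > 0] the elements [q v ^+ m * x v] are in [U], so an
    identity [f] of [U] vanishes at them.  Scalars move to the left of a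
    product of homogeneous elements at the cost of applying powers of [theta],
    so the value of a word [w] is multiplied by [l w ^+ m], where the nonzero
    scalar [l w] does not depend on [m] ([skew_prod_scale]).  Each coefficient
    of the value of [f] is thus an exponential sum in [m] with nonzero bases,
    which vanishes for all [m > 0]; it satisfies a linear recurrence with
    nonzero constant term, hence also vanishes for [m = 0]
    ([exp_sum_eq0]), which says that [f] vanishes at [x]. *)

(** The exponential sum satisfies the linear recurrence with characteristic
    polynomial [p], the product of the ['X - (l i)%:P], and this recurrence
    can be run backwards because [p`_0] is a product of the [- l i]. *)
Lemma exp_sum_eq0 (R : idomainType) (I : eqType) (s : seq I) (c l : I -> R) :
    (forall i, l i != 0) ->
    (forall m, (0 < m)%N -> \sum_(i <- s) l i ^+ m * c i = 0) ->
  \sum_(i <- s) c i = 0.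
Proof.
move=> l_neq0 sum_eq0; pose p := \prod_(a <- map l s) ('X - a%:P).
have p0_neq0 : p`_0 != 0.
  rewrite -horner_coef0 -/(root p 0) root_prod_XsubC.
  by apply/mapP => -[i _ /esym/eqP]; apply/negP.
have size_p : size p = (size s).+1 by rewrite size_prod_XsubC size_map.
have p_l : \sum_(i <- s) p.[l i] * c i = 0.
  rewrite big_seq big1 // => i si.
  have /rootP -> : root p (l i) by rewrite root_prod_XsubC map_f.
  by rewrite mul0r.
apply/eqP; rewrite -(mulrI_eq0 _ (mulfI p0_neq0)); apply/eqP.
(* Expand each [p.[l i]]: by hypothesis only the constant terms contribute. *)
rewrite -[RHS]p_l mulr_sumr.
under [RHS]eq_bigr => i _ do
  rewrite horner_coef size_p big_ord_recl expr0 mulr1 mulrDl.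
rewrite big_split /= -[LHS]addr0; congr (_ + _).
under eq_bigr => i _ do rewrite mulr_suml.
rewrite exchange_big big1 // => k _.
under eq_bigr => i _ do rewrite -mulrA.
by rewrite -mulr_sumr sum_eq0 ?mulr0.
Qed.

Section SkewAlgebra.
Variables (K : comNzRingType) (G : zmodType).

Lemma skew_coefZ (L : algType K) (phi : algAction G L)
    (k : K) (u : skewalg phi) g :
  skew_coef (k *: u) g = k *: skew_coef u g.
Proof. exact: skew_scaleE. Qed.

Lemma skew_coef_sum (L : algType K) (phi : algAction G L)
    (I : Type) (s : seq I) (u : I -> skewalg phi) g :
  skew_coef (\sum_(i <- s) u i) g = \sum_(i <- s) skew_coef (u i) g.
Proof. exact: raddf_sum. Qed.

Lemma skew_coefMl (L : algType K) (phi : algAction G L)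
    (a : L) (u : skewalg phi) g :
  skew_coef (skewU phi 0 a * u) g = a * skew_coef u g.
Proof.
elim/skew_ind: u => [|u v Hu Hv|h b].
- by rewrite mulr0 /skew_coef mcoeff0 mulr0.
- by rewrite mulrDr !skew_coefD Hu Hv mulrDr.
by rewrite skewUM act0 add0r !skew_coefU mulrnAr.
Qed.

Variables (L : idomAlgType K) (phi : algAction G L).

Lemma act_eq0 g (a : L) : (phi g a == 0) = (a == 0).
Proof.
have actK : cancel (phi g) (phi (- g)).
  by move=> b; rewrite -[LHS]/((phi (- g) \o phi g) b) -actD addNr act0.
exact: raddf_eq0 (can_inj actK).
Qed.

(** The scalar that comes out on the left of a product of homogeneous elements
    of degrees [deg i] when each factor is multiplied by [q i]. *)
Fixpoint twisted_prod (I : Type) (deg : I -> G) (q : I -> L) (s : seq I) : L :=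
  if s is i :: s' then q i * phi (deg i) (twisted_prod deg q s') else 1.

Lemma twisted_prod_neq0 (I : Type) (deg : I -> G) (q : I -> L) (s : seq I) :
  (forall i, q i != 0) -> twisted_prod deg q s != 0.
Proof.
move=> q_neq0; elim: s => [|i s IHs] /=; first exact: oner_neq0.
by rewrite mulf_neq0 ?act_eq0.
Qed.

(** The commutativity of [L] makes the scalar on the right independent of
    [x]. *)
Lemma skew_prod_scale (I : Type) (deg : I -> G) (q : I -> L)
    (x : I -> skewalg phi) (m : nat) (s : seq I) :
    (forall i, skew_gr (deg i) (x i)) ->
  \prod_(i <- s) (skewU phi 0 (q i ^+ m) * x i) =
    skewU phi 0 (twisted_prod deg q s ^+ m) * \prod_(i <- s) x i.
Proof.
move=> x_gr; elim: s => [|i s IHs] /=.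
  by rewrite !big_nil expr1n mulr1.
rewrite !big_cons IHs !mulrA; congr (_ * _).
have [a ->] := x_gr i.
rewrite !skewUM !act0 !add0r addr0 exprMn rmorphXn -!mulrA.
by congr (skewU _ _ (_ * _)); rewrite mulrC.
Qed.

End SkewAlgebra.

Lemma skew_coef_free_eval (K : comNzRingType) (G : zmodType) (L : algType K)
    (phi : algAction G L) (x : int * nat -> skewalg phi) (f : free_Zalg K) g :
  skew_coef (free_eval x f) g =
    \sum_(w <- msupp f) f@_w *: skew_coef (\prod_(i <- w) x i) g.
Proof.
rewrite /free_eval /mmap skew_coef_sum; apply: eq_bigr => w _.
by rewrite -scalerAl mul1r skew_coefZ.
Qed.

Section GaloisRing.
Variables (K : fieldType) (D : idomAlgType K) (t : algAut D).
Variables (U : frac_skewZ t -> Prop) (Ugr : int -> frac_skewZ t -> Prop).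
Hypothesis galU : graded_Galois_ring U Ugr.
Local Notation phi := (aut_action (frac_aut t)).
Local Notation coef := (skew_coef (phi := phi)).

Lemma graded_Galois_mul n (q : D) x :
  Ugr n x -> Ugr n (skewU phi 0 q%:F * x).
Proof.
move=> Ux; rewrite -[n]add0r; apply: (gr_mul (Galois_grading galU)) => //.
by apply: (Galois_dom galU); exists q.
Qed.

(** Write [skewU phi n 1] as a sum of products of elements of [F] and of [U]:
    one of the factors in [U] has a nonzero component of degree [n]. *)
Lemma graded_Galois_neq0 n :
  exists2 b : {fraction D}, b != 0 & Ugr n (skewU phi n b).
Proof.
have [s [s_in s_sum]] := Galois_FU galU (skewU phi n 1).
have /hasP [p ps] : has (fun p => coef p.2 n != 0) s.
  apply/negPn/negP => /hasPn s0.
  have /eqP := congr1 (fun u => coef u n) s_sum.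
  rewrite skew_coefU eqxx skew_coef_sum big_seq big1 ?oner_eq0 // => p ps.
  have [[a ->] _] := s_in p ps.
  by rewrite skew_coefMl; have /negPn/eqP -> := s0 p ps; rewrite mulr0.
have [_ Up] := s_in p ps.
have [r [c [r_uniq c_gr ->]]] := gr_span (Galois_grading galU) Up.
have c_coef m : exists b, c m = skewU phi m b.
  exact: (Galois_graded galU).
move=> coef_neq0; have [b cn] := c_coef n; exists b; last by rewrite -cn.
apply: contraNneq coef_neq0 => b0.
rewrite skew_coef_sum big1 // => m _.
have [d cm] := c_coef m; rewrite cm skew_coefU.
have [mn|//] := eqVneq m n.
by move: cm; rewrite mn cn b0 => /(congr1 (fun u => coef u n));
  rewrite !skew_coefU eqxx => <-.
Qed.

Lemma graded_Galois_denominator n x : frac_gr (t := t) n x ->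
  exists2 q : D, q != 0 & Ugr n (skewU phi 0 q%:F * x).
Proof.
case=> a ->; have [b b_neq0 Ub] := graded_Galois_neq0 n.
have [p [q q_neq0 ab]] : exists p, exists2 q, q != 0 & a / b = p%:F / q%:F.
  by elim/frac_ind: (a / b) => p q q_neq0; exists p, q.
exists q => //; suff -> : skewU phi 0 q%:F * skewU phi n a =
    skewU phi 0 p%:F * skewU phi n b by exact: graded_Galois_mul.
rewrite !skewUM !act0; congr (skewU _ _ _).
have qF_neq0 : q%:F != 0 by rewrite tofrac_eq0.
by apply/eqP; rewrite mulrC -eqr_div // ab.
Qed.

End GaloisRing.

Theorem theorem22 (K : fieldType) (charK0 : [pchar K] =i pred0)
    (Gamma : idomAlgType K) (affineG : affine Gamma)
    (theta : algAut Gamma) (theta_inf : aut_infinite_order theta)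
    (U : frac_skewZ theta -> Prop) (Ugr : int -> frac_skewZ theta -> Prop)
    (galU : graded_Galois_ring U Ugr) :
  forall f : free_Zalg K,
    graded_identity Ugr f <-> graded_identity (@frac_gr K Gamma theta) f.
Proof.
move=> f; split=> idf x x_gr; last first.
  by apply: idf => i; apply: (Galois_graded galU).
have [q q_neq0 qxU] : exists2 q : int * nat -> Gamma, forall i, q i != 0 &
    forall i, Ugr i.1 (skewU (aut_action (frac_aut theta)) 0 (q i)%:F * x i).
  suff /functional_choice [q Hq] : forall i, exists q : Gamma, q != 0 /\
      Ugr i.1 (skewU (aut_action (frac_aut theta)) 0 q%:F * x i).
    by exists q => i; have [] := Hq i.
  by move=> i; have [q] := graded_Galois_denominator galU (x_gr i); exists q.
apply: skewP => g; rewrite skew_coef_free_eval [RHS]mcoeff0.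
pose l := twisted_prod (aut_action (frac_aut theta)) fst (fun i => (q i)%:F).
apply: (exp_sum_eq0 (l := fun w : {fmonom (int * nat)%type} => l w)).
  by move=> w; apply: twisted_prod_neq0 => i; rewrite tofrac_eq0.
case=> // m _.
(* One factor [q i] takes [x i] into [U], and [U] absorbs the other [m]. *)
pose y i := skewU (aut_action (frac_aut theta)) 0 ((q i)%:F ^+ m.+1) * x i.
have yU i : Ugr i.1 (y i).
  have -> : y i = skewU (aut_action (frac_aut theta)) 0 (q i ^+ m)%:F *
      (skewU (aut_action (frac_aut theta)) 0 (q i)%:F * x i).
    by rewrite mulrA skewUM act0 addr0 rmorphXn -exprSr.
  exact: (graded_Galois_mul galU).
transitivity (skew_coef (free_eval y f) g); last first.
  by rewrite (idf y yU) /skew_coef mcoeff0.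
rewrite skew_coef_free_eval; apply: eq_bigr => w _.
by rewrite (skew_prod_scale (deg := fst)) // skew_coefMl scalerAr.
Qed.
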